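(* Suppose the adaptive robust binary optimization problem $$\min_{\mathbf{x}\in\mathcal{X}}\ \max_{\boldsymbol{\xi}\in\Xi}\ \min_{\mathbf{y}\in\mathcal{Y}\cap\mathcal{S}(\mathbf{x})}\ \mathbf{c}^\top\mathbf{x}+\boldsymbol{\xi}^\top\mathbf{y}$$ has selective adaptability. Then its formulation as the infinite-dimensional model $$\min_{v,\ \mathbf{x},\ (\mathbf{y}^{\xi})_{\boldsymbol{\xi}\in\Xi}}\ \mathbf{c}^\top\mathbf{x}+v\quad\text{s.t.}\quad \boldsymbol{\xi}^\top\mathbf{y}^{\xi}\le v,\ \ \mathbf{y}^{\xi}\in\mathcal{Y},\ \ \mathbf{y}^{\xi}\in\mathcal{S}(\mathbf{x})\ \ \forall\boldsymbol{\xi}\in\Xi,\qquad \mathbf{x}\in\mathcal{X},\ v\in\mathbb{R}$$ can be reformulated as the following model, in which $\mathbf{y}\in\mathbb{R}^n$ is a single vector of continuous variables: $$\min_{v,\ \mathbf{x},\ \mathbf{y}}\ \mathbf{c}^\top\mathbf{x}+v\quad\text{s.t.}\quad \boldsymbol{\xi}^\top\mathbf{y}\le v\ \ \forall\boldsymbol{\xi}\in\Xi,\quad \mathbf{y}\in\operatorname{conv}(\mathcal{Y}),\quad \mathbf{y}\in\mathcal{S}(\mathbf{x}),\quad \mathbf{x}\in\mathcal{X},\ v\in\mathbb{R}.$$ That is, the two models have the same optimal value and the same set of optimal first-stage decisions $\mathbf{x}$.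
   Context: Let $m,n$ be positive integers, $\mathbf{c}\in\mathbb{R}^m$, $\mathcal{X}\subseteq\{0,1\}^m$, and $\mathcal{Y}=\{\mathbf{y}\in\{0,1\}^n\mid\mathbf{G}\mathbf{y}\ge\mathbf{h}\}$ for a real matrix $\mathbf{G}$ and real vector $\mathbf{h}$. The uncertainty set $\Xi=\{\boldsymbol{\xi}\in\mathbb{R}^n\mid\mathbf{T}\boldsymbol{\xi}\le\mathbf{d}\}$ is a nonempty bounded polyhedron. The problem has selective adaptability if, for pairwise disjoint sets $\mathcal{U}_1,\mathcal{U}_2,\mathcal{U}_3\subseteq\{1,\ldots,n\}\times\{1,\ldots,m\}$, $$\mathcal{S}(\mathbf{x})=\{\mathbf{y}\in\mathbb{R}^n\mid y_i\le x_j\ \forall(i,j)\in\mathcal{U}_1,\ y_i=x_j\ \forall(i,j)\in\mathcal{U}_2,\ y_i\ge x_j\ \forall(i,j)\in\mathcal{U}_3\}.$$ The minimum over an empty (infeasible) set is $+\infty$. A first-stage decision $\mathbf{x}$ is called optimal for a model if it is the $\mathbf{x}$-component of some feasible solution attaining the optimal value. *)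

(* Defs.v *)
From HB Require Import structures.
From mathcomp Require Import all_boot all_order all_algebra.
From mathcomp Require Import all_classical all_reals all_analysis.

Set Implicit Arguments.
Unset Strict Implicit.
Unset Printing Implicit Defensive.

Import Order.TTheory GRing.Theory Num.Theory.
Import numFieldNormedType.Exports.

Local Open Scope classical_set_scope.
Local Open Scope ring_scope.

Definition dot (R : realType) (k : nat) (u v : 'cV[R]_k) : R :=
  \sum_(i < k) u i 0 * v i 0.

Definition binary_vectors (R : realType) (k : nat) : set 'cV[R]_k :=
  [set z | forall i, z i 0 = 0 \/ z i 0 = 1].

Definition polyhedron (R : realType) (q n : nat)
    (T : 'M[R]_(q, n)) (d : 'cV[R]_q) : set 'cV[R]_n :=
  [set xi | forall k, (T *m xi) k 0 <= d k 0].

Definition binary_polyhedron (R : realType) (p n : nat)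
    (G : 'M[R]_(p, n)) (h : 'cV[R]_p) : set 'cV[R]_n :=
  [set y | binary_vectors y /\ forall k, h k 0 <= (G *m y) k 0].

Definition convex_hull (R : realType) (n : nat) (A : set 'cV[R]_n) :
    set 'cV[R]_n :=
  smallest (fun C : set 'cV[R]_n => convex_set C) A.

Definition selective_set (R : realType) (m n : nat)
    (U1 U2 U3 : {set 'I_n * 'I_m}) (x : 'cV[R]_m) : set 'cV[R]_n :=
  [set y | [/\ forall i j, (i, j) \in U1 -> y i 0 <= x j 0,
               forall i j, (i, j) \in U2 -> y i 0 = x j 0 &
               forall i j, (i, j) \in U3 -> y i 0 >= x j 0]].

Definition selective_adaptability (R : realType) (m n : nat)
    (S : 'cV[R]_m -> set 'cV[R]_n) : Prop :=
  exists U1 U2 U3 : {set 'I_n * 'I_m},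
    [/\ [disjoint U1 & U2]%B, [disjoint U1 & U3]%B, [disjoint U2 & U3]%B &
        forall x, S x = selective_set U1 U2 U3 x].

(* Solutions are triples (v, x, y).  Here y is the recourse family, indexed by
   the points of Xi: the set Xi is coerced to the type of its elements. *)
Definition adaptive_feasible (R : realType) (m n : nat)
    (X : set 'cV[R]_m) (Y : set 'cV[R]_n) (S : 'cV[R]_m -> set 'cV[R]_n)
    (Xi : set 'cV[R]_n) : set (R * 'cV[R]_m * (Xi -> 'cV[R]_n)) :=
  [set z | let: (v, x, y) := z in
     [/\ X x & forall xi : Xi,
               [/\ dot (\val xi) (y xi) <= v, Y (y xi) & S x (y xi)]]].

Arguments adaptive_feasible {R m n} X Y S Xi _.

Definition static_feasible (R : realType) (m n : nat)
    (X : set 'cV[R]_m) (Y : set 'cV[R]_n) (S : 'cV[R]_m -> set 'cV[R]_n)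
    (Xi : set 'cV[R]_n) : set (R * 'cV[R]_m * 'cV[R]_n) :=
  [set z | let: (v, x, y) := z in
     [/\ X x, forall xi, Xi xi -> dot xi y <= v, convex_hull Y y & S x y]].

Definition objective (R : realType) (m : nat) (V : Type) (c : 'cV[R]_m)
    (z : R * 'cV[R]_m * V) : R :=
  dot c z.1.2 + z.1.1.

(* +oo when F is empty, since ereal_inf set0 = +oo. *)
Definition optimal_value (R : realType) (m : nat) (V : Type) (c : 'cV[R]_m)
    (F : set (R * 'cV[R]_m * V)) : \bar R :=
  ereal_inf [set (objective c z)%:E | z in F].

Definition optimal_decisions (R : realType) (m : nat) (V : Type)
    (c : 'cV[R]_m) (F : set (R * 'cV[R]_m * V)) : set 'cV[R]_m :=
  [set z.1.2 | z in [set z | F z /\ (objective c z)%:E = optimal_value c F]].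

(* Main.v *)
Require Import Defs.
From mathcomp Require Import all_boot all_order all_algebra.
From mathcomp Require Import all_classical all_reals all_analysis.
From mathcomp Require Import ring lra.
Import Order.TTheory GRing.Theory Num.Theory.
Import numFieldNormedType.Exports.
Local Open Scope classical_set_scope.
Local Open Scope ring_scope.

(** Fix a first-stage decision x and a level v.  The two models agree as soon
    as x and v extend to a feasible solution of the one exactly when they extend
    to a feasible solution of the other, because the objective only reads v and
    x ([same_projection_same_optima]).

    From a single y to a family.  Since x is binary, each selective constraint
    compares a coordinate of y in [0, 1] with 0 or 1.  Such a constraint is
    either void on the cube or cuts out a face of it, so a convex combination
    of binary points can only satisfy it if every point of positive weight
    does.  Hence y in conv(Y) that lies in S(x) is a convex combination of
    points of Y that lie in S(x), and for each xi one of these has a cost at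
    most that of y ([hull_selective_dominated]).

    From a family to a single y.  The set of points of Y in S(x) is finite, and
    the hypothesis says that for every xi one of them has cost at most v.  The
    minimax theorem provides one point of its convex hull that has cost at
    most v for all xi at once ([hull_selective_minimax]).

    The minimax theorem needed here concerns finitely many functions that are
    affine in xi.  It is proved by induction on their number
    ([finite_minimax]): restricting the convex set to the part where the first
    function exceeds v leaves a problem with one function fewer, and the
    combination found there is then merged with the first function.  This
    reduces everything to two affine functions ([separate_two_affine]), where
    the weight is found as a supremum of ratios. *)

(** * Convex sets *)

Section ConvexSets.
Context {R : realType} {V : lmodType R}.
Implicit Types (A : set V) (a b : V).

(** The endpoints of a segment being trivial, convexity may be checked on
    positive weights, which is what the face argument below requires. *)
Lemma convex_set_open_segment A :
  (forall a b t, 0 < t < 1 -> A a -> A b -> A (t *: a + (1 - t) *: b)) ->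
  convex_set A.
Proof.
move=> cA; apply/convex_setW => a b aA bA k k0 k1.
apply/mem_set; apply: cA; first by rewrite k0.
- exact: set_mem aA.
- exact: set_mem bA.
Qed.

Lemma convex_set_segment {A a b t} : convex_set A ->
  0 <= t <= 1 -> A a -> A b -> A (t *: a + (1 - t) *: b).
Proof.
move=> cA /andP[t0 t1] /mem_set aA /mem_set bA.
exact: set_mem (cA a b (Itv01 t0 t1) aA bA).
Qed.

End ConvexSets.

Section Vectors.
Context {R : realType} {n : nat}.
Implicit Types (a b y xi : 'cV[R]_n) (t : R).

Lemma convex_hull_convex (A : set 'cV[R]_n) : convex_set (convex_hull A).
Proof.
apply: convex_set_open_segment => a b t /andP[t0 t1] aA bA C [cC AC].
by apply: convex_set_segment => //; [rewrite !ltW|exact: aA|exact: bA].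
Qed.

Lemma combE {k : nat} t (a b : 'cV[R]_k) i :
  (t *: a + (1 - t) *: b) i 0 = t * a i 0 + (1 - t) * b i 0.
Proof. by rewrite !mxE. Qed.

Lemma dotC a b : dot a b = dot b a.
Proof. by apply: eq_bigr => i _; rewrite mulrC. Qed.

Lemma dot_combr t xi a b :
  dot xi (t *: a + (1 - t) *: b) = t * dot xi a + (1 - t) * dot xi b.
Proof.
rewrite /dot !mulr_sumr -big_split /=; apply: eq_bigr => i _.
by rewrite combE; ring.
Qed.

Lemma dot_combl t xi a b :
  dot (t *: a + (1 - t) *: b) xi = t * dot a xi + (1 - t) * dot b xi.
Proof. by rewrite dotC dot_combr ![dot xi _]dotC. Qed.

Lemma polyhedron_convex (q : nat) (T : 'M[R]_(q, n)) (d : 'cV[R]_q) :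
  convex_set (polyhedron T d).
Proof.
apply: convex_set_open_segment => a b t /andP[t0 t1] aP bP k.
rewrite mulmxDr -!scalemxAr combE.
have := aP k; have := bP k; nra.
Qed.

End Vectors.

(** * A finite minimax theorem *)

(** The image of C under (f, g) is a convex subset of the plane that misses the
    open positive quadrant; (t, 1 - t) is the normal of a line separating the
    two.  Points with 0 < g bound the weight t from below, points with 0 < f
    bound it from above, and [cross] says that these bounds are compatible. *)
Lemma separate_two_affine {R : realType} {V : lmodType R} (C : set V)
    (f g : V -> R) :
  convex_set C ->
  (forall a b t, f (t *: a + (1 - t) *: b) = t * f a + (1 - t) * f b) ->
  (forall a b t, g (t *: a + (1 - t) *: b) = t * g a + (1 - t) * g b) ->
  (forall r, C r -> f r <= 0 \/ g r <= 0) ->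
  exists2 t, 0 <= t <= 1 & forall r, C r -> t * f r + (1 - t) * g r <= 0.
Proof.
move=> cC fE gE fg_le0.
have f_le0 r : C r -> 0 < g r -> f r <= 0 by move=> /fg_le0 []; lra.
have g_le0 r : C r -> 0 < f r -> g r <= 0 by move=> /fg_le0 []; lra.
have cross p q : C p -> C q -> 0 < g p -> 0 < f q -> g p * f q <= g q * f p.
  move=> Cp Cq gp fq; rewrite leNgt; apply/negP => lt_gf.
  have fp := f_le0 _ Cp gp; have gq := g_le0 _ Cq fq.
  (* At the point of [p, q] on the diagonal f = g, the common value of f and g
     would be positive. *)
  pose w := (f q - g q) + (g p - f p).
  have w0 : 0 < w by rewrite /w; lra.
  pose t := (f q - g q) / w.
  have tE : 1 - t = (g p - f p) / w.
    by rewrite -(divff (lt0r_neq0 w0)) -mulrBl /w addrAC subrr add0r.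
  have t01 : 0 <= t <= 1.
    by rewrite -[t <= 1]subr_ge0 tE !divr_ge0 ?(ltW w0)//; lra.
  have := fg_le0 _ (convex_set_segment cC t01 Cp Cq).
  rewrite fE gE tE /t.
  have -> : (f q - g q) / w * f p + (g p - f p) / w * f q
      = (g p * f q - g q * f p) / w by ring.
  have -> : (f q - g q) / w * g p + (g p - f p) / w * g q
      = (g p * f q - g q * f p) / w by ring.
  have : 0 < (g p * f q - g q * f p) / w by rewrite divr_gt0// subr_gt0.
  lra.
(* The lower bounds on t, with 0 added so that the supremum is over a nonempty
   set even if g <= 0 on C. *)
pose E := [set 0] `|` [set g p / (g p - f p) | p in C `&` [set p | 0 < g p]].
have E0 : E 0 by left.
have E1 : ubound E 1.
  move=> _ [->|[p [Cp /= gp] <-]]; first exact: ler01.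
  have fp := f_le0 _ Cp gp; rewrite ler_pdivrMr; lra.
have L0 : 0 <= sup E by apply: ub_le_sup => //; exists 1.
have L1 : sup E <= 1 by apply: ge_sup => //; exists 0.
exists (sup E) => [|r Cr]; first by rewrite L0.
have [gr|gr] := ltP 0 (g r).
  have fr := f_le0 _ Cr gr.
  have : g r / (g r - f r) <= sup E.
    by apply: ub_le_sup; [exists 1|right; exists r].
  rewrite ler_pdivrMr; last lra.
  nra.
have [fr|fr] := ltP 0 (f r); last by nra.
have : sup E <= - g r / (f r - g r).
  apply: ge_sup; first by exists 0.
  move=> _ [->|[p [Cp /= gp] <-]]; first by apply: divr_ge0; lra.
  have fp := f_le0 _ Cp gp; have := cross _ _ Cp Cr gp fr.
  rewrite ler_pdivrMr; last lra.
  rewrite mulrAC ler_pdivlMr; last lra.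
  nra.
rewrite ler_pdivlMr; last lra.
nra.
Qed.

(** Stating the conclusion in an arbitrary convex H that contains the points,
    rather than in their hull, lets the induction go through unchanged.  C is
    generalized too, as the inductive step passes to the convex part C' of C
    where the first point costs more than v; there the other points suffice,
    so that the resulting y and the first point a are never both too
    expensive on C. *)
Lemma finite_minimax {R : realType} {n : nat} (H : set 'cV[R]_n) (v : R)
    (a : 'cV[R]_n) (s : seq 'cV[R]_n) (C : set 'cV[R]_n) :
  convex_set H -> (forall b, b \in a :: s -> H b) -> convex_set C ->
  (forall xi, C xi -> exists2 b, b \in a :: s & dot xi b <= v) ->
  exists2 y, H y & forall xi, C xi -> dot xi y <= v.
Proof.
move=> cH; elim: s a C => [|b s IHs] a C sH cC Cs.
  exists a; first by apply: sH; rewrite mem_head.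
  by move=> xi /Cs[b]; rewrite inE => /eqP ->.
have Ha : H a by apply: sH; rewrite mem_head.
pose C' := C `&` [set xi | v < dot xi a].
have cC' : convex_set C'.
  apply: convex_set_open_segment => p q t /andP[t0 t1] [Cp vp] [Cq vq].
  split; first by apply: convex_set_segment => //; rewrite !ltW.
  by move: vp vq; rewrite /= dot_combl; nra.
have [| |y Hy yP] := IHs b C' _ cC'.
- by move=> z zs; apply: sH; rewrite inE zs orbT.
- move=> xi [/Cs[z]]; rewrite inE => /predU1P[->|zs] zv /=.
    by rewrite ltNge zv.
  by exists z.
pose f xi := dot xi a - v; pose g xi := dot xi y - v.
have [t t01 tP] : exists2 t, 0 <= t <= 1 &
    forall xi, C xi -> t * f xi + (1 - t) * g xi <= 0.
  apply: separate_two_affine => //.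
  - by move=> p q t; rewrite /f dot_combl; ring.
  - by move=> p q t; rewrite /g dot_combl; ring.
  - move=> xi Cxi; have [fv|fv] := leP (dot xi a) v.
      by left; rewrite subr_le0.
    by right; rewrite subr_le0; apply: yP.
exists (t *: a + (1 - t) *: y); first exact: convex_set_segment.
by move=> xi /tP; rewrite dot_combr /f /g; lra.
Qed.

(** * Binary vectors and the selective constraints *)

Lemma binary_vectors_finite {R : realType} {n : nat} :
  exists s : seq 'cV[R]_n, forall y, binary_vectors y -> y \in s.
Proof.
exists [seq \col_i (f i : bool)%:R | f : {ffun 'I_n -> bool}] => y yb.
apply/mapP; exists [ffun i => y i 0 == 1]; first by rewrite mem_enum.
apply/colP => i; rewrite mxE ffunE.
by case: (yb i) => ->; rewrite ?eqxx // eq_sym oner_eq0.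
Qed.

(** 0 and 1 are the extreme points of [0, 1]: a bound by one of them that holds
    in the interior of a segment of [0, 1] holds at both endpoints. *)
Section BinaryFaces.
Context {R : realType} (t a b z : R).
Hypotheses (t01 : 0 < t < 1) (a01 : 0 <= a <= 1) (b01 : 0 <= b <= 1).
Hypothesis zb : z = 0 \/ z = 1.

Lemma comb_le_binary : t * a + (1 - t) * b <= z -> a <= z /\ b <= z.
Proof.
move: t01 a01 b01 => /andP[t0 t1] /andP[a0 a1] /andP[b0 b1].
by case: zb => ->; split; nra.
Qed.

Lemma comb_ge_binary : z <= t * a + (1 - t) * b -> z <= a /\ z <= b.
Proof.
move: t01 a01 b01 => /andP[t0 t1] /andP[a0 a1] /andP[b0 b1].
by case: zb => ->; split; nra.
Qed.

End BinaryFaces.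

Section SelectiveSet.
Context {R : realType} {m n : nat} (U1 U2 U3 : {set 'I_n * 'I_m}).
Context (x : 'cV[R]_m).
Local Notation Sx := (selective_set U1 U2 U3 x).

Lemma selective_set_convex : convex_set Sx.
Proof.
apply: convex_set_open_segment => a b t /andP[t0 t1] [a1 a2 a3] [b1 b2 b3].
split=> i j ijU; rewrite combE.
- by have := a1 _ _ ijU; have := b1 _ _ ijU; nra.
- by rewrite (a2 _ _ ijU) (b2 _ _ ijU); ring.
- by have := a3 _ _ ijU; have := b3 _ _ ijU; nra.
Qed.

(** Every selective constraint bounds one coordinate by 0 or 1, so each is void
    on the unit cube or cuts out a face of it; their intersection is a face. *)
Lemma selective_set_face (xb : binary_vectors x) (a b : 'cV[R]_n) t :
  0 < t < 1 ->
  (forall i, 0 <= a i 0 <= 1) -> (forall i, 0 <= b i 0 <= 1) ->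
  Sx (t *: a + (1 - t) *: b) -> Sx a /\ Sx b.
Proof.
move=> t01 a01 b01 [S1 S2 S3].
have leS i j : (t *: a + (1 - t) *: b) i 0 <= x j 0 ->
    a i 0 <= x j 0 /\ b i 0 <= x j 0.
  by rewrite combE; apply: comb_le_binary.
have geS i j : x j 0 <= (t *: a + (1 - t) *: b) i 0 ->
    x j 0 <= a i 0 /\ x j 0 <= b i 0.
  by rewrite combE; apply: comb_ge_binary.
have eqS i j : (i, j) \in U2 -> a i 0 = x j 0 /\ b i 0 = x j 0.
  move=> /S2 e; have [ax bx] := leS i j ltac:(by rewrite e).
  have [xa xb'] := geS i j ltac:(by rewrite e).
  by split; apply: le_anti; rewrite ?ax ?bx.
split; split=> i j ijU.
- by have [] := leS _ _ (S1 _ _ ijU).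
- by have [] := eqS _ _ ijU.
- by have [] := geS _ _ (S3 _ _ ijU).
- by have [] := leS _ _ (S1 _ _ ijU).
- by have [] := eqS _ _ ijU.
- by have [] := geS _ _ (S3 _ _ ijU).
Qed.

(** The proof avoids explicit convex combinations: the points for which the
    claim holds form a convex set D, by the face property and because the
    linear cost of a combination is at least the smaller of the two costs. *)
Lemma hull_selective_dominated (xb : binary_vectors x) (Y : set 'cV[R]_n)
    (Yb : Y `<=` @binary_vectors R n) (xi y : 'cV[R]_n) :
  convex_hull Y y -> Sx y ->
  exists2 y', Y y' /\ Sx y' & dot xi y' <= dot xi y.
Proof.
pose D := [set y : 'cV[R]_n | (forall i, 0 <= y i 0 <= 1) /\ (Sx y ->
  exists2 y', Y y' /\ Sx y' & dot xi y' <= dot xi y)].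
suff hullD : convex_hull Y `<=` D by move=> /hullD[].
apply: smallest_sub => [|z Yz]; last first.
  split=> [i|Sz]; last by exists z.
  by case: (Yb _ Yz i) => ->; rewrite lexx ler01.
apply: convex_set_open_segment => a b t t01 [a01 aD] [b01 bD].
have [t0 t1] := andP t01.
split=> [i|Sab].
  have /andP[a0 a1] := a01 i; have /andP[b0 b1] := b01 i.
  by rewrite combE; apply/andP; split; nra.
have [Sa Sb] := selective_set_face xb _ _ _ t01 a01 b01 Sab.
have [a' a'P a'le] := aD Sa; have [b' b'P b'le] := bD Sb.
rewrite dot_combr; have [ab|ba] := leP (dot xi a') (dot xi b').
- by exists a' => //; nra.
- by exists b' => //; nra.
Qed.

(** The binary recourse decisions form a finite set, and both the hull of Y and
    the selective set are convex, so [finite_minimax] yields y in both.  A point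
    of C is needed to have at least one candidate in the list. *)
Lemma hull_selective_minimax (Y : set 'cV[R]_n)
    (Yb : Y `<=` @binary_vectors R n) (v : R) (C : set 'cV[R]_n) :
  C !=set0 -> convex_set C ->
  (forall xi, C xi -> exists y, [/\ dot xi y <= v, Y y & Sx y]) ->
  exists y, [/\ forall xi, C xi -> dot xi y <= v, convex_hull Y y & Sx y].
Proof.
move=> [xi0 Cxi0] cC CP; have [s sP] := @binary_vectors_finite R n.
pose s' := [seq y <- s | `[< Y y /\ Sx y >]].
have s'P y : Y y -> Sx y -> y \in s'.
  by move=> Yy Sy; rewrite mem_filter sP ?andbT; [apply/asboolP|exact: Yb].
have s'H b : b \in s' -> (convex_hull Y `&` Sx) b.
  rewrite mem_filter => /andP[/asboolP[Yb' Sb] _].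
  by split=> //; exact: sub_gen_smallest.
have cH : convex_set (convex_hull Y `&` Sx).
  apply: convex_set_open_segment => a b t /andP[t0 t1] [Ya Sa] [Yb' Sb].
  have t01 : 0 <= t <= 1 by rewrite !ltW.
  split; first exact: convex_set_segment (convex_hull_convex _) t01 Ya Yb'.
  exact: convex_set_segment selective_set_convex t01 Sa Sb.
have Cs' xi : C xi -> exists2 b, b \in s' & dot xi b <= v.
  by move=> /CP[y [yv Yy Sy]]; exists y => //; exact: s'P.
case: s' s'P s'H Cs' => [|a s'] s'P s'H Cs'.
  by have [b] := Cs' _ Cxi0.
have [y [Yy Sy] yv] := finite_minimax _ v a s' C cH s'H cC Cs'.
by exists y.
Qed.

End SelectiveSet.

(** * Equivalence of the two models *)

Lemma same_projection_same_optima {R : realType} {m : nat} {V V' : Type}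
    (c : 'cV[R]_m) (F : set (R * 'cV[R]_m * V)) (F' : set (R * 'cV[R]_m * V')) :
  (forall v x, (exists y, F (v, x, y)) <-> (exists y', F' (v, x, y'))) ->
  optimal_value c F = optimal_value c F' /\
  optimal_decisions c F = optimal_decisions c F'.
Proof.
move=> FF'.
have valE : optimal_value c F = optimal_value c F'.
  congr ereal_inf; apply/seteqP; split=> _ [[[v x] y] Fz <-].
  - have [y' F'z] := (FF' v x).1 (ex_intro _ y Fz).
    by exists (v, x, y').
  - have [y' F'z] := (FF' v x).2 (ex_intro _ y Fz).
    by exists (v, x, y').
split=> //; apply/seteqP; split=> _ [[[v x] y] [Fz optz] <-] /=.
- have [y' F'z] := (FF' v x).1 (ex_intro _ y Fz).
  by exists (v, x, y') => //; split=> //; rewrite -valE.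
- have [y' F'z] := (FF' v x).2 (ex_intro _ y Fz).
  by exists (v, x, y') => //; split=> //; rewrite valE.
Qed.

Theorem proposition1 (R : realType) (m n p q : nat)
    (m_gt0 : (0 < m)%N) (n_gt0 : (0 < n)%N)
    (c : 'cV[R]_m) (X : set 'cV[R]_m) (X_binary : X `<=` @binary_vectors R m)
    (G : 'M[R]_(p, n)) (h : 'cV[R]_p)
    (T : 'M[R]_(q, n)) (d : 'cV[R]_q)
    (Xi_nonempty : polyhedron T d !=set0)
    (Xi_bounded : bounded_set (polyhedron T d))
    (S : 'cV[R]_m -> set 'cV[R]_n) (S_selective : selective_adaptability S) :
  let Y := binary_polyhedron G h in
  let Xi := polyhedron T d in
  optimal_value c (adaptive_feasible X Y S Xi) =
    optimal_value c (static_feasible X Y S Xi) /\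
  optimal_decisions c (adaptive_feasible X Y S Xi) =
    optimal_decisions c (static_feasible X Y S Xi).
Proof.
move=> Y Xi; have Yb : Y `<=` @binary_vectors R n by move=> y [].
have [U1 [U2 [U3 [_ _ _ SE]]]] := S_selective.
apply: same_projection_same_optima => v x; split.
- move=> [y [Xx yP]].
  have [xi Xixi|y' [y'v Yy' Sy']] := @hull_selective_minimax _ _ _ U1 U2 U3 x
      Y Yb v Xi Xi_nonempty (@polyhedron_convex _ _ _ T d).
    have [yv Yy Sy] := yP (SigSub (mem_set Xixi)).
    by exists (y (SigSub (mem_set Xixi))); rewrite -SE.
  by exists y'; split=> //; rewrite SE.
- move=> [y [Xx yv Yy Sy]].
  suff /choice[f fP] : forall xi : Xi, exists y',
      [/\ dot (\val xi) y' <= v, Y y' & S x y'] by exists f.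
  move=> xi; rewrite SE in Sy *.
  have [y' [Yy' Sy'] y'v] := hull_selective_dominated U1 U2 U3 x
    (X_binary _ Xx) Y Yb (\val xi) y Yy Sy.
  exists y'; split=> //; apply: le_trans y'v _; apply: yv.
  exact: set_mem (valP xi).
Qed.
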